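(* (a) There exists an absolute constant $c$ such that for every $n\in\mathbb{N}_+$ and every $F\in H_1(G)$ $$\|S_nF\|_{H_1}\le c\,V(n)\,\|F\|_{H_1}.$$ (b) Let $\{m_k:k\ge0\}$ be any increasing sequence of positive integers such that $\sup_{k\in\mathbb{N}}V(m_k)=\infty$, and let $\Phi:\mathbb{N}_+\to[1,\infty)$ be any nondecreasing function satisfying $$\limsup_{k\to\infty}\frac{V(m_k)}{\Phi(m_k)}=\infty .$$ Then there exists a martingale $F\in H_1(G)$ such that $$\sup_{k\in\mathbb{N}}\left\|\frac{S_{m_k}F}{\Phi(m_k)}\right\|_1=\infty .$$
   Context: $\mathbb{N}_+$ is the set of positive integers and $\mathbb{N}=\mathbb{N}_+\cup\{0\}$. $G=\prod_{k=0}^\infty Z_2$ is the dyadic (Walsh) group, i.e. the set of sequences $x=(x_0,x_1,\dots)$, $x_k\in\{0,1\}$, with coordinatewise addition mod 2, product topology, and normalized Haar measure $\mu$ (the product of the measures giving mass $1/2$ to each point of $Z_2$). Put $I_0(x)=G$, $I_n(x)=\{y\in G: y_0=x_0,\dots,y_{n-1}=x_{n-1}\}$, and let $\zeta_n$ be the $\sigma$-algebra generated by $\{I_n(x):x\in G\}$. For $n\in\mathbb{N}$ with binary expansion $n=\sum_{j\ge0}n_j2^j$, $n_j\in\{0,1\}$, the variation of $n$ is $V(n)=n_0+\sum_{k=1}^\infty|n_k-n_{k-1}|$. Rademacher functions: $r_k(x)=(-1)^{x_k}$. Walsh functions: $w_n(x)=\prod_{k\ge0}r_k(x)^{n_k}$,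 $n\in\mathbb{N}$. A martingale $F=(F_n,n\in\mathbb{N})$ is a martingale with respect to $(\zeta_n)_{n\in\mathbb N}$. Its maximal function is $F^*=\sup_n|F_n|$; $H_1(G)$ is the space of martingales with $\|F\|_{H_1}:=\|F^*\|_1<\infty$, where $\|f\|_1=\int_G|f|\,d\mu$. Walsh–Fourier coefficients of a martingale: $\widehat F(k)=\lim_{n\to\infty}\int_GF_nw_k\,d\mu$ (the limit always exists). Partial sums: $S_nF=\sum_{k=0}^{n-1}\widehat F(k)w_k$; in particular $S_{2^n}F=F_n$. An integrable function $f$ (such as $S_nF$) is identified with the martingale $(E(f\mid\zeta_n))_{n}$ of its conditional expectations when its $H_1$ norm is taken. *)

(* Defs.v *)
From HB Require Import structures.
From mathcomp Require Import all_boot all_order all_algebra.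
From mathcomp Require Import all_classical all_reals all_analysis.
From mathcomp Require Import measurable_realfun lra.

Set Implicit Arguments.
Unset Strict Implicit.
Unset Printing Implicit Defensive.

Import Order.TTheory GRing.Theory Num.Theory.
Import numFieldNormedType.Exports.

Local Open Scope classical_set_scope.
Local Open Scope ring_scope.

(* Sequences of bits with the Borel sigma-algebra of the product topology. The
   group law plays no role below, only the Haar measure does. *)
Definition dyadic_group : Type := g_sigma_algebraType (@open cantor_space).

Definition dyadic_interval (n : nat) (x : dyadic_group) : set dyadic_group :=
  [set y | forall k, (k < n)%N -> y k = x k].

Lemma open_dyadic_interval n (x : dyadic_group) :
  open (dyadic_interval n x : set cantor_space).
Proof.
elim: n => [|n IHn].
  rewrite (_ : dyadic_interval 0 x = setT); first exact: openT.
  by apply/seteqP; split.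
rewrite (_ : dyadic_interval n.+1 x =
  dyadic_interval n x `&` (fun y : cantor_space => y n) @^-1` [set x n]).
  apply: openI => //; apply: open_comp; last exact: discrete_open.
  by move=> y _; apply: (@proj_continuous nat (fun=> bool)).
apply/seteqP; split => y /=.
  by move=> yx; split=> [k kn|]; apply: yx => //; exact: ltnW.
by move=> [yx yn] k; rewrite ltnS leq_eqVlt => /predU1P[->//|]; exact: yx.
Qed.

Lemma measurable_dyadic_interval n (x : dyadic_group) :
  measurable (dyadic_interval n x).
Proof. by apply: sub_sigma_algebra; exact: open_dyadic_interval. Qed.

Lemma dyadic_interval_eq n (x y : dyadic_group) :
  dyadic_interval n x y -> dyadic_interval n x = dyadic_interval n y.
Proof.
by move=> xy; apply/seteqP; split => z zx k kn; rewrite zx// xy.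
Qed.

Lemma open_dyadic_base (U : set cantor_space) (x : cantor_space) :
  open U -> U x -> exists n, dyadic_interval n x `<=` U.
Proof.
move=> oU Ux; apply: contrapT => /forallNP nU.
have /choice[y yP] n : exists y : cantor_space,
    dyadic_interval n x y /\ ~ U y.
  by have /existsNP[y /not_implyP[]] := nU n; exists y.
have yx : {ptws, y @ \oo --> x}.
  apply/pointwise_cvgP => k A /nbhs_singleton Axk.
  exists k.+1 => // n /= kn; rewrite (_ : y n k = x k)//.
  exact: (yP n).1.
have [N _ NU] : \forall n \near \oo, U (y n).
  by apply: yx; apply: open_nbhs_nbhs.
by apply: (yP N).2; apply: NU => /=.
Qed.

Lemma dyadic_open_bigcup (U : set cantor_space) : open U ->
  U = \bigcup_(s : seq bool)
    (if pselect (dyadic_interval (size s) (nth false s) `<=` U)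
     then dyadic_interval (size s) (nth false s) else set0).
Proof.
move=> oU; apply/seteqP; split => [x Ux|x [s _]]; last first.
  by case: pselect => // sU /sU.
have [n xU] := open_dyadic_base oU Ux.
have E : dyadic_interval n x = dyadic_interval n (nth false (mkseq x n)).
  by apply: dyadic_interval_eq => k kn; rewrite nth_mkseq.
exists (mkseq x n) => //; rewrite size_mkseq -E.
by case: pselect.
Qed.

(* The Haar measure is realized as the image of Lebesgue measure on [0, 1[
   under binary expansion; x_k is read off the k-th iterate of the doubling
   map. *)
Fixpoint doubling {R : realType} (k : nat) (t : R) : R :=
  if k is k'.+1 then 2 * doubling k' t - (2^-1 <= doubling k' t :> R)%:R
  else t.

Definition binary_digits {R : realType} (t : R) : dyadic_group :=
  fun k => 2^-1 <= doubling k t :> R.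

Lemma measurable_binary_digit {R : realType} k :
  measurable_fun setT (fun t : R => binary_digits t k).
Proof.
suff md : measurable_fun setT (doubling k : R -> R).
  by apply: measurable_fun_ler => //; exact: measurable_cst.
elim: k => [|k mk] /=; first exact: measurable_id.
apply: measurable_funB; first exact: measurable_funM.
have -> : (fun t : R => (2^-1 <= doubling k t :> R)%:R) =
    (fun t : R => if 2^-1 <= doubling k t :> R then 1 else 0 : R).
  by apply/funext => t; case: ifP.
apply: measurable_fun_ifT => //.
by apply: measurable_fun_ler.
Qed.

Lemma measurable_binary_digits {R : realType} :
  measurable_fun setT (@binary_digits R).
Proof.
apply: (@measurability _ _ _ dyadic_group setT _ (@open cantor_space)) => // _ [U oU <-].
rewrite setTI (dyadic_open_bigcup oU) preimage_bigcup.
apply: countable_bigcupT_measurable => // s.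
case: pselect => [sU|sU] /=; last by rewrite preimage_set0.
move: sU => _.
elim: (size s) => [|n IHn].
  by rewrite (_ : _ @^-1` _ = setT)//; apply/seteqP; split.
have := @measurable_binary_digit R n measurableT [set nth false s n] I.
rewrite setTI => /(measurableI _ _ IHn); congr measurable.
apply/seteqP; split => t /=.
  move=> [tn tn'] k; rewrite ltnS leq_eqVlt => /predU1P[->//|]; exact: tn.
by move=> tn; split=> [k kn|]; apply: tn => //; exact: ltnW.
Qed.

Lemma binary_digits_interval {R : realType} (n : nat) (x : dyadic_group) :
  exists a : R,
    [/\ 0 <= a, a + 2^-n <= 1 &
    forall t, 0 <= t < 1 ->
     (dyadic_interval n x (binary_digits t) <-> a <= t < a + 2^-n) /\
     (a <= t < a + 2^-n -> doubling n t = 2 ^+ n * (t - a))].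
Proof.
elim: n => [|n [a [a0 a1 IHn]]].
  exists 0; split; rewrite ?expr0 ?invr1 ?add0r// => t t01.
  by split=> [|_]; [split|rewrite /= mul1r subr0].
have e0 : 0 < 2 ^- n.+1 :> R by rewrite invr_gt0 exprn_gt0.
have eE : 2 ^- n = 2 * 2 ^- n.+1 :> R.
  by rewrite exprS invfM mulVKf.
have eV : 2 ^+ n * 2 ^- n.+1 = 2^-1 :> R.
  by rewrite exprS invfM mulrC -mulrA mulVf ?mulr1// expf_neq0.
set e : R := 2 ^- n.+1 in e0 eE eV *.
have p0 : 0 < 2 ^+ n :> R by rewrite exprn_gt0.
exists (if x n then a + e else a); split.
- by case: (x n); lra.
- by case: (x n); lra.
move=> t t01; have [[xt tx] dt] := IHn t t01.
have half : a <= t < a + 2 ^- n -> binary_digits t n = (a + e <= t).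
  move=> /dt; rewrite /binary_digits => ->; rewrite -eV ler_pM2l//.
  by rewrite lerBrDl.
have step : dyadic_interval n.+1 x (binary_digits t) <->
    (a <= t < a + 2 ^- n) /\ (a + e <= t) = x n.
  split=> [h|[h hn] k].
    have h' : a <= t < a + 2 ^- n.
      by apply: xt => k kn; apply: h; exact: ltnW.
    by split=> //; rewrite -half//; exact: h.
  rewrite ltnS leq_eqVlt => /predU1P[->|]; first by rewrite half.
  exact: tx.
split.
  rewrite step; case: (x n); split.
  - by move=> [/andP[h1 h2] h3]; rewrite h3/=; lra.
  - by move=> /andP[h1 h2]; split=> //; lra.
  - by move=> [/andP[h1 h2] /negbT]; rewrite -ltNge => h3; lra.
  - by move=> /andP[h1 h2]; split; [lra|apply/negbTE; rewrite -ltNge].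
move=> h.
have h' : a <= t < a + 2 ^- n by move: h; case: (x n) => /andP[? ?]; lra.
have -> : doubling n.+1 t = 2 * doubling n t - (binary_digits t n)%:R by [].
rewrite half// dt//.
have -> : (a + e <= t) = x n.
  by move: h; case: (x n) => /andP[? ?]; [|apply/negbTE; rewrite -ltNge].
rewrite exprS -mulrA; case: (x n).
  have -> : 1%:R = 2 * (2 ^+ n * e) :> R by rewrite eV divff.
  lra.
by rewrite subr0.
Qed.

Lemma haar_exists (R : realType) : exists mu : probability dyadic_group R,
  forall n x, mu (dyadic_interval n x) = (2 ^- n)%:E.
Proof.
pose D : set R := `[0, 1[%classic.
have mD : measurable D by exact: measurable_itv.
pose l := mrestr (@lebesgue_measure R) mD.
pose mu := pushforward l (@binary_digits R).
have md A : measurable A -> measurable (@binary_digits R @^-1` A).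
  by move=> mA; rewrite -[X in measurable X]setTI; exact: measurable_binary_digits.
have muI n x : mu (dyadic_interval n x) = (2 ^- n)%:E.
  have [a [a0 a1 aP]] := @binary_digits_interval R n x.
  have e0 : 0 < 2 ^- n :> R by rewrite invr_gt0 exprn_gt0.
  rewrite /mu /pushforward /l /mrestr.
  rewrite (_ : _ `&` _ = `[a, a + 2 ^- n[%classic).
    by rewrite lebesgue_measure_itv/= lte_fin ltrDl e0 -EFinB addrC addKr.
  apply/seteqP; split => t /=; rewrite !in_itv/=.
    by move=> [h /aP[[+ _] _]]; exact.
  move=> h; have t01 : 0 <= t < 1 by move: h => /andP[? ?]; lra.
  by split=> //; apply/(aP _ t01).1.
have mu0 : mu set0 = 0%E by rewrite /mu /pushforward preimage_set0; exact: measure0.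
have mu_ge0 A : (0 <= mu A)%E by rewrite /mu /pushforward /l; exact: measure_ge0.
have mu_sigma : semi_sigma_additive mu.
  move=> F mF tF mUF; rewrite /mu /pushforward /l preimage_bigcup.
  apply: measure_semi_sigma_additive.
  - by move=> n; exact: md.
  - apply/trivIsetP => /= i j _ _ ij; rewrite -preimage_setI.
    by move/trivIsetP : tF => /(_ _ _ _ _ ij) ->//; rewrite preimage_set0.
  - by rewrite -preimage_bigcup; exact: md.
have mu1 : mu setT = 1%E.
  rewrite (_ : setT = dyadic_interval 0 point).
    by rewrite muI expr0 invr1.
  by apply/seteqP; split.
clearbody mu.
pose hm := isMeasure.Build _ _ _ mu mu0 mu_ge0 mu_sigma.
pose m : {measure set dyadic_group -> \bar R} := HB.pack mu hm.
pose P : probability dyadic_group R :=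
  HB.pack mu hm (Measure_isProbability.Build _ _ _ m mu1).
by exists P.
Qed.

(* The values on the dyadic intervals, which form a generating pi-system,
   determine a unique probability: the product of the uniform measures on
   {0, 1}. *)
Definition haar (R : realType) : probability dyadic_group R :=
  projT1 (cid (haar_exists R)).

Lemma haar_dyadic_interval (R : realType) n x :
  haar R (dyadic_interval n x) = (2 ^- n)%:E.
Proof. by rewrite /haar; case: cid. Qed.

Definition zeta (n : nat) : set (set dyadic_group) :=
  <<s range (dyadic_interval n) >>.

Definition zeta_measurable (R : realType) (n : nat) (f : dyadic_group -> R) :=
  measurable_fun setT
    (f : g_sigma_algebraType (range (dyadic_interval n)) -> R).

Lemma zetaP n (A : set dyadic_group) :
  zeta n A <-> forall x y, A x -> dyadic_interval n x y -> A y.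
Proof.
split=> [zA x y Ax xy|sA].
  suff : zeta n `<=` [set B | forall x y, B x -> dyadic_interval n x y -> B y].
    by move=> /(_ _ zA) /(_ x y); exact.
  apply: smallest_sub => [|_ [z _ <-] u v zu uv k kn]; last by rewrite uv// zu.
  split=> //= [B sB u v [_ nBu] uv|F sF u v [i _ Fu] uv].
    split=> // Bv; apply: nBu; apply: sB Bv _ => k kn; by rewrite uv.
  by exists i => //; exact: sF Fu uv.
rewrite (_ : A = \bigcup_(s : seq bool)
    (if pselect (A (nth false s)) then dyadic_interval n (nth false s)
     else set0)).
  apply: (@countable_bigcupT_measurable _
    (g_sigma_algebraType (range (dyadic_interval n)))) => // s.
  case: pselect => [sU|sU] /=; last exact: measurable0.
  by apply: sub_sigma_algebra; exists (nth false s).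
apply/seteqP; split => [x Ax|x [s _]]; last first.
  by case: pselect => // As /sA; exact.
exists (mkseq x n) => //.
have xs : dyadic_interval n x (nth false (mkseq x n)).
  by move=> k kn; rewrite nth_mkseq.
case: pselect => [As|nAs] /=; first by move=> k kn; rewrite nth_mkseq.
by apply: nAs; exact: sA xs.
Qed.

Lemma sub_zeta n : zeta n `<=` measurable.
Proof.
apply: smallest_sub; first exact: sigma_algebra_measurable.
by move=> _ [x _ <-]; exact: measurable_dyadic_interval.
Qed.

Lemma zeta_measurableP (R : realType) n (f : dyadic_group -> R) :
  zeta_measurable n f <->
  forall x y, dyadic_interval n x y -> f y = f x.
Proof.
split=> [mf x y xy|cf].
  have := mf measurableT _ (measurable_set1 (f x)).
  rewrite setTI => /zetaP /(_ x y); exact.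
move=> _ Y mY; rewrite setTI; apply/zetaP => x y /= fx xy.
by rewrite (cf _ _ xy).
Qed.

Definition is_condexp (R : realType) (n : nat) (f g : dyadic_group -> R) :=
  [/\ zeta_measurable n g, (haar R).-integrable setT (EFin \o g) &
      forall A, zeta n A ->
        \int[haar R]_(x in A) g x = \int[haar R]_(x in A) f x].

(* By condexpP and is_condexpE below, for integrable f such a g exists and is
   unique pointwise: every atom of [zeta n] has positive measure. *)
Definition condexp (R : realType) (n : nat) (f : dyadic_group -> R) :
    dyadic_group -> R :=
  xget (cst 0) (is_condexp n f).

Lemma is_condexpE (R : realType) n (f g : dyadic_group -> R) x :
  is_condexp n f g ->
  g x = 2 ^+ n * \int[haar R]_(y in dyadic_interval n x) f y.
Proof.
move=> [/zeta_measurableP mg ig fg]; rewrite -fg; last first.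
  by apply: sub_sigma_algebra; exists x.
rewrite (@eq_Rintegral _ _ _ (haar R) _ (cst (g x))); last first.
  by move=> y /set_mem xy /=; exact: mg.
rewrite Rintegral_cst; last exact: measurable_dyadic_interval.
by rewrite /= haar_dyadic_interval mulrCA mulfV ?mulr1// expf_neq0.
Qed.

Lemma Rintegral_dyadic_split (R : realType) n (f : dyadic_group -> R) :
  (haar R).-integrable setT (EFin \o f) ->
  \int[haar R]_x f x =
  \sum_(t : n.-tuple bool)
    \int[haar R]_(x in dyadic_interval n (nth false t)) f x.
Proof.
move=> fi; pose F (t : n.-tuple bool) := dyadic_interval n (nth false t).
have mF t : measurable (F t) by exact: measurable_dyadic_interval.
have FT : \big[setU/set0]_(t : n.-tuple bool) F t = setT.
  apply/seteqP; split => // x _; rewrite -bigcup_seq.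
  have xn : size (mkseq x n) == n by rewrite size_mkseq.
  exists (Tuple xn) => /=; first by rewrite mem_index_enum.
  by move=> k kn; rewrite nth_mkseq.
rewrite /Rintegral -FT integral_bigsetU_EFin//; last 3 first.
- exact: index_enum_uniq.
- apply/trivIsetP => s t _ _ st; rewrite -subset0 => x [xs xt].
  move/eqP: st; apply; apply: val_inj; apply: (@eq_from_nth _ false).
    by rewrite !size_tuple.
  by move=> k; rewrite size_tuple => kn; rewrite -xs// xt.
- by rewrite FT; case/integrableP: fi.
rewrite -sum_fine// => t _; apply: integrable_fin_num => //.
exact: integrableS fi.
Qed.

Lemma is_condexp_mean (R : realType) n (f : dyadic_group -> R) :
  (haar R).-integrable setT (EFin \o f) ->
  is_condexp n f
    (fun x => 2 ^+ n * \int[haar R]_(y in dyadic_interval n x) f y).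
Proof.
move=> fi; set g := (fun x : dyadic_group => _).
have mI := @measurable_dyadic_interval n.
have cg x y : dyadic_interval n x y -> g y = g x.
  by move=> xy; rewrite /g (dyadic_interval_eq xy).
have zg : zeta_measurable n g by apply/zeta_measurableP.
have gi : (haar R).-integrable setT (EFin \o g).
  apply: measurable_bounded_integrable => //.
  - by rewrite /= probability_setT ltry.
  - move=> _ Y mY; have := zg measurableT Y mY; rewrite !setTI.
    exact: sub_zeta.
  pose M : R := \sum_(t : n.-tuple bool) `|g (nth false t)|.
  exists M; split => [|z Mz x _]; first by rewrite num_real.
  have xn : size (mkseq x n) == n by rewrite size_mkseq.
  apply: le_trans (ltW Mz); rewrite (@cg (nth false (Tuple xn))); last first.
    by move=> k kn; rewrite nth_mkseq.
  by rewrite /M (bigD1 (Tuple xn))//= lerDl sumr_ge0.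
split => // A zA; have mA := sub_zeta zA.
have ri h : (haar R).-integrable setT (EFin \o h) ->
    (haar R).-integrable setT (EFin \o (h \_ A)).
  move=> hi; rewrite -restrict_EFin; apply/(integrable_mkcond _ mA).
  exact: integrableS hi.
rewrite Rintegral_mkcond [RHS]Rintegral_mkcond.
rewrite !(@Rintegral_dyadic_split _ n)//; try exact: ri.
apply: eq_bigr => t _; set x := nth false t.
have [Ax|nAx] := pselect (A x).
  have E h : \int[haar R]_(y in dyadic_interval n x) (h \_ A) y =
      \int[haar R]_(y in dyadic_interval n x) h y.
    apply: eq_Rintegral => y /set_mem xy; rewrite patchE mem_set//.
    by apply: (zetaP n A).1 xy.
  rewrite !E (@eq_Rintegral _ _ _ (haar R) _ (cst (g x))); last first.
    by move=> y /set_mem /cg.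
  rewrite Rintegral_cst//= haar_dyadic_interval /g mulrAC.
  by rewrite mulfV ?mul1r// expf_neq0.
have E h : \int[haar R]_(y in dyadic_interval n x) (h \_ A) y =
    \int[haar R]_(y in dyadic_interval n x) 0.
  apply: eq_Rintegral => y /set_mem xy; rewrite patchE memNset// => Ay.
  by apply: nAx; apply: (zetaP n A).1 Ay _ => // k kn; rewrite xy.
by rewrite !E.
Qed.

Lemma condexpP (R : realType) n (f : dyadic_group -> R) :
  (haar R).-integrable setT (EFin \o f) -> is_condexp n f (condexp n f).
Proof. by move=> fi; apply: xgetPex; eexists; exact: is_condexp_mean fi. Qed.

(* Taking m = n gives adaptedness and integrability. *)
Definition is_martingale (R : realType) (F : nat -> dyadic_group -> R) :=
  forall m n, (m <= n)%N -> is_condexp m (F n) (F m).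

Definition maximal_function (R : realType) (F : nat -> dyadic_group -> R)
    (x : dyadic_group) : \bar R :=
  ereal_sup (range (fun n => `|F n x|%:E)).

Definition L1norm (R : realType) (f : dyadic_group -> R) : \bar R :=
  'N[haar R]_1[EFin \o f].

Definition H1norm (R : realType) (F : nat -> dyadic_group -> R) : \bar R :=
  'N[haar R]_1[maximal_function F].

Definition in_H1 (R : realType) (F : nat -> dyadic_group -> R) :=
  is_martingale F /\ (H1norm F < +oo)%E.

Definition martingale_of (R : realType) (f : dyadic_group -> R) :
    nat -> dyadic_group -> R :=
  fun n => condexp n f.

Definition bit (n k : nat) : nat := odd (n %/ 2 ^ k).

Lemma bit_small n k : (n <= k)%N -> bit n k = 0%N.
Proof.
move=> nk; rewrite /bit divn_small//.
by rewrite (leq_ltn_trans nk)// ltn_expl.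
Qed.

(* By bit_small, the terms k > n of the infinite sum, and the factors k >= n
   of the infinite product defining [walsh], are trivial. *)
Definition dyadic_variation (n : nat) : nat :=
  (bit n 0 + \sum_(1 <= k < n.+1) `|(bit n k)%:Z - (bit n k.-1)%:Z|)%N.

Definition rademacher (R : realType) (k : nat) (x : dyadic_group) : R :=
  (-1) ^+ x k.

Definition walsh (R : realType) (n : nat) (x : dyadic_group) : R :=
  \prod_(k < n) rademacher R k x ^+ bit n k.

Definition walsh_coef (R : realType) (F : nat -> dyadic_group -> R)
    (k : nat) : R :=
  limn (fun n => \int[haar R]_x (F n x * walsh R k x)).

Definition walsh_sum (R : realType) (n : nat) (F : nat -> dyadic_group -> R)
    (x : dyadic_group) : R :=
  \sum_(k < n) walsh_coef F k * walsh R k x.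

(* Main.v *)
Require Import Defs.
From mathcomp Require Import all_boot all_order all_algebra.
From mathcomp Require Import all_classical all_reals all_analysis.
From mathcomp Require Import measurable_realfun lra ring.

Import Order.TTheory GRing.Theory Num.Theory.
Import numFieldNormedType.Exports.

Local Open Scope classical_set_scope.
Local Open Scope ring_scope.

Set Implicit Arguments.
Unset Strict Implicit.
Unset Printing Implicit Defensive.

(* (a) From D_n = w_n sum_j n_j (D_{2^(j+1)} - D_{2^j}), Abel summation gives
   S_n F = w_n sum_k e_k E_k(w_n F) with sum_k |e_k| = V(n), whence
   |S_n F|_1 <= V(n) |F|_1. As E_m(S_n F) is F_m when 2^m <= n and S_n F
   otherwise, the maximal function of S_n F is at most F^* + |S_n F|, so that
   |S_n F|_{H_1} <= (1 + V(n)) |F|_{H_1} <= 2 V(n) |F|_{H_1}.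
   (b) On I_l(0) \ I_{l+1}(0) one has |D_n| >= 2^(l-1) |n_l - n_{l-1}|, hence
   |D_n|_1 >= V(n) / 4. Choose k_i >= 2^i with V(m_{k_i}) > 4^i Phi(m_{k_i}),
   let L_i >= i be the position of the top bit of m_{k_i} and take
   F = sum_i 2^-i (D_{2^(L_i + 1)} - D_{2^L_i}), whose maximal function is
   dominated by sum_i 2^-i D_{2^L_i}. With j = L_i and c_j >= 2^-i the weight
   of the j-th hump, S_{m_{k_i}} F = F_j + c_j (D_{m_{k_i}} - D_{2^j}) has
   L_1 norm at least 2^-i V(m_{k_i}) / 4 - 4.
   All integrals reduce to finite averages, since every function involved
   except the maximal ones depends on finitely many coordinates. *)

(** * The Dirichlet kernel *)

Lemma bit_pow2D m n j : (n < 2 ^ m)%N ->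
  bit (2 ^ m + n) j = if (j < m)%N then bit n j else (j == m).
Proof.
move=> nm; rewrite /bit; case: ltngtP => [jm|mj|->].
- rewrite divnDl ?dvdn_exp2l// 1?ltnW//.
  by rewrite -expnB// 1?ltnW// oddD oddX subn_eq0 leqNgt jm.
- rewrite divn_small//; apply: (@leq_trans (2 ^ m.+1)); last by rewrite leq_exp2l.
  by rewrite expnS mul2n -addnn ltn_add2l.
- by rewrite divnDl// divnn expn_gt0/= divn_small.
Qed.

Lemma bit_large n k : (n < 2 ^ k)%N -> bit n k = 0%N.
Proof. by move=> nk; rewrite /bit divn_small. Qed.

Section walsh_kernel.
Variable R : realType.
Implicit Types (x y : dyadic_group) (m n j k : nat).

(** Both products agree with the one over [maxn n m]: every factor added has a vanishing bit. This
    replaces the range [n] of the definition by any number of binary digits that holds [n]. *)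
Lemma walshE m n x : (n < 2 ^ m)%N ->
  walsh R n x = \prod_(k < m) rademacher R k x ^+ bit n k.
Proof.
move=> nm.
have ext p M : (p <= M)%N -> (forall k, (p <= k)%N -> bit n k = 0%N) ->
    \prod_(k < M) rademacher R k x ^+ bit n k =
    \prod_(k < p) rademacher R k x ^+ bit n k.
  move=> pM b0; rewrite -!(big_mkord xpredT (fun k => rademacher R k x ^+ bit n k)).
  rewrite (big_cat_nat (leq0n p) pM)/= [X in _ * X]big_nat_cond.
  rewrite [X in _ * X]big1 ?mulr1// => k.
  by rewrite andbT => /andP[pk _]; rewrite b0// expr0.
transitivity (\prod_(k < maxn n m) rademacher R k x ^+ bit n k).
  by symmetry; apply: ext; [rewrite leq_maxl|exact: bit_small].
apply: ext; first by rewrite leq_maxr.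
move=> k mk; apply: bit_large; apply: (leq_trans nm); by rewrite leq_exp2l.
Qed.

Lemma walsh0 x : walsh R 0 x = 1.
Proof. by rewrite /walsh big_ord0. Qed.

Lemma walsh_pow2D m n x : (n < 2 ^ m)%N ->
  walsh R (2 ^ m + n) x = rademacher R m x * walsh R n x.
Proof.
move=> nm; rewrite (@walshE m.+1); last first.
  by rewrite expnS mul2n -addnn ltn_add2l.
rewrite (walshE x nm) big_ord_recr/= mulrC bit_pow2D// ltnn eqxx expr1.
by congr (_ * _); apply: eq_bigr => i _; rewrite bit_pow2D// ltn_ord.
Qed.

Lemma normr_walsh n x : `|walsh R n x| = 1.
Proof.
rewrite /walsh normr_prod big1// => i _.
by rewrite normrX /rademacher normrX normrN1 !expr1n.
Qed.

Lemma walsh_agree m n x y : (n < 2 ^ m)%N -> dyadic_interval m x y ->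
  walsh R n y = walsh R n x.
Proof.
move=> nm xy; rewrite !(walshE _ nm); apply: eq_bigr => i _.
by rewrite /rademacher xy.
Qed.

Lemma walsh_sqr n x : walsh R n x * walsh R n x = 1.
Proof.
by rewrite -expr2 -[X in X = _]ger0_norm ?sqr_ge0// normrX normr_walsh expr1n.
Qed.

(** The Dirichlet kernel D_{2^m} at x + y (see [walsh_kernel_pow2]). Averaging against it is the
    conditional expectation on [zeta m]. *)
Definition atom_kernel m x y : R := 2 ^+ m * \1_(dyadic_interval m x) y.

Lemma indic_atomS m x y : \1_(dyadic_interval m.+1 x) y =
  (x m == y m)%:R * \1_(dyadic_interval m x) y :> R.
Proof.
rewrite !indicE -natrM mulnb; congr (nat_of_bool _ )%:R.
apply/idP/idP => [/set_mem h|/andP[/eqP e /set_mem h]].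
  by rewrite (h m)// eqxx/=; apply/mem_set => k km; apply: h; exact: ltnW.
apply/mem_set => k; rewrite ltnS leq_eqVlt => /predU1P[->//|]; exact: h.
Qed.

Lemma atom_kernel0 x y : atom_kernel 0 x y = 1.
Proof. by rewrite /atom_kernel expr0 mul1r indicE mem_set. Qed.

Lemma atom_kernelS m x y : atom_kernel m.+1 x y =
  (1 + rademacher R m x * rademacher R m y) * atom_kernel m x y.
Proof.
rewrite /atom_kernel indic_atomS exprS /rademacher.
by case: (x m); case: (y m) => /=; rewrite ?expr0 ?expr1; ring.
Qed.

Lemma atom_kernel_ge0 m x y : 0 <= atom_kernel m x y.
Proof. by rewrite /atom_kernel mulr_ge0 ?exprn_ge0// indicE. Qed.

(** D_n at x + y, because w_k(x) w_k(y) = w_k(x + y); two variables take the place of the group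
    law. *)
Definition walsh_kernel n x y : R := \sum_(k < n) walsh R k x * walsh R k y.

Lemma walsh_kernel_pow2D m n x y : (n <= 2 ^ m)%N ->
  walsh_kernel (2 ^ m + n) x y = walsh_kernel (2 ^ m) x y +
    rademacher R m x * rademacher R m y * walsh_kernel n x y.
Proof.
move=> nm; rewrite /walsh_kernel big_split_ord/= mulr_sumr; congr (_ + _).
apply: eq_bigr => i _; have im := leq_trans (ltn_ord i) nm.
by rewrite !walsh_pow2D//; ring.
Qed.

Lemma walsh_kernel_pow2 m x y : walsh_kernel (2 ^ m) x y = atom_kernel m x y.
Proof.
elim: m => [|m IHm].
  by rewrite /walsh_kernel big_ord1/= !walsh0 mulr1 atom_kernel0.
by rewrite expnS mul2n -addnn walsh_kernel_pow2D// IHm atom_kernelS; ring.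
Qed.

(** On the support of the kernel, x and y share their first [m] bits, so the two Walsh signs cancel.
    Read backwards, this supplies D_{2^m} with the factor w_n that the induction for [walsh_kernelE]
    pulls out. *)
Lemma walsh_atom_kernel m n x y : (n < 2 ^ m)%N ->
  walsh R n x * walsh R n y * atom_kernel m x y = atom_kernel m x y.
Proof.
move=> nm; rewrite /atom_kernel indicE.
have [/set_mem xy|] := boolP (y \in dyadic_interval m x); last by rewrite !mulr0.
by rewrite (walsh_agree nm xy) walsh_sqr mul1r.
Qed.

Lemma atom_kernel_diff m x y : atom_kernel m.+1 x y - atom_kernel m x y =
  rademacher R m x * rademacher R m y * atom_kernel m x y.
Proof. by rewrite atom_kernelS; ring. Qed.

Lemma rademacher_sqr m x : rademacher R m x * rademacher R m x = 1.
Proof. by rewrite /rademacher -expr2 sqrr_sign. Qed.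

(* The classical formula D_n = w_n sum_j n_j (D_{2^(j+1)} - D_{2^j}) for the
   Dirichlet kernel, in its translation-invariant two-variable form. *)
Lemma walsh_kernelE m n x y : (n < 2 ^ m)%N ->
  walsh_kernel n x y = walsh R n x * walsh R n y *
    \sum_(j < m) (bit n j)%:R * (atom_kernel j.+1 x y - atom_kernel j x y).
Proof.
elim: m n => [|m IHm] n.
  by rewrite ltnS leqn0 => /eqP ->; rewrite /walsh_kernel !big_ord0 mulr0.
rewrite big_ord_recr/=; have [nm _|mn nm] := ltnP n (2 ^ m).
  by rewrite bit_large// mul0r addr0 IHm.
have nE : n = (2 ^ m + (n - 2 ^ m))%N by rewrite subnKC.
move: nE; set p := (n - 2 ^ m)%N => nE.
have pm : (p < 2 ^ m)%N by rewrite /p ltn_subLR// addnn -mul2n -expnS.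
rewrite nE walsh_kernel_pow2D 1?ltnW// walsh_kernel_pow2.
rewrite (eq_bigr (fun j : 'I_m =>
  (bit p j)%:R * (atom_kernel j.+1 x y - atom_kernel j x y))); last first.
  by move=> j _; rewrite bit_pow2D// ltn_ord.
rewrite (IHm _ pm) bit_pow2D// ltnn eqxx !walsh_pow2D// mul1r atom_kernel_diff.
rewrite -{1}(walsh_atom_kernel x y pm).
have := rademacher_sqr m x; have := rademacher_sqr m y.
set s := \sum_(_ < _) _; set a := rademacher R m x; set b := rademacher R m y.
move=> b1 a1; rewrite mulrDr addrC; congr (_ + _); first by ring.
transitivity ((a * a) * (b * b) * (walsh R p x * walsh R p y * atom_kernel m x y)).
  by rewrite a1 b1 !mul1r.
by ring.
Qed.

End walsh_kernel.

(** * Averages over finitely many coordinates *)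

Section dyadic_average.
Variable R : realType.
Implicit Types (x y : dyadic_group) (f g h : dyadic_group -> R).

Definition depends_on N f := forall x y, dyadic_interval N x y -> f y = f x.

Lemma depends_on_le m n f : (m <= n)%N -> depends_on m f -> depends_on n f.
Proof. by move=> mn fm x y xy; apply: fm => k km; apply: xy; exact: leq_trans mn. Qed.

Lemma depends_on_mul N f g : depends_on N f -> depends_on N g ->
  depends_on N (fun x => f x * g x).
Proof. by move=> fN gN x y xy; rewrite (fN x) ?(gN x). Qed.

Lemma depends_on_sum N n (F : nat -> dyadic_group -> R) :
  (forall k, (k < n)%N -> depends_on N (F k)) ->
  depends_on N (fun x => \sum_(k < n) F k x).
Proof. by move=> FN x y xy; apply: eq_bigr => i _; exact: FN. Qed.

Lemma depends_on_walsh N k : (k < 2 ^ N)%N -> depends_on N (walsh R k).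
Proof. by move=> kN x y xy; exact: walsh_agree xy. Qed.

Lemma depends_on_atom m x : depends_on m (atom_kernel R m x).
Proof.
move=> y z yz; rewrite /atom_kernel !indicE; congr (_ * (nat_of_bool _)%:R).
by apply/idP/idP => /set_mem h; apply/mem_set => k km; rewrite -(h k km) yz.
Qed.

Lemma depends_on_normr N f : depends_on N f -> depends_on N (fun x => `|f x|).
Proof. by move=> fN x y xy; rewrite (fN x). Qed.

Lemma depends_on_measurable N f : depends_on N f -> measurable_fun setT f.
Proof.
move=> /zeta_measurableP fN _ Y mY; have := fN measurableT Y mY; rewrite !setTI.
exact: sub_zeta.
Qed.

Lemma prefix_agree N x : exists t : N.-tuple bool, dyadic_interval N (nth false t) x.
Proof.
have xn : size (mkseq x N) == N by rewrite size_mkseq.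
by exists (Tuple xn) => k kN; rewrite nth_mkseq.
Qed.

Lemma depends_on_integrable N f : depends_on N f ->
  (haar R).-integrable setT (EFin \o f).
Proof.
move=> fN; apply: measurable_bounded_integrable => //.
- by rewrite /= probability_setT ltry.
- exact: depends_on_measurable fN.
pose M : R := \sum_(t : N.-tuple bool) `|f (nth false t)|.
exists M; split => [|z Mz x _]; first by rewrite num_real.
apply: le_trans (ltW Mz); have [t /fN ->] := prefix_agree N x.
by rewrite /M (bigD1 t)//= lerDl sumr_ge0.
Qed.

(** For [f] depending on the first [N] coordinates this is the Haar integral, each atom being
    sampled at its point with zeros from place [N] on. Fubini becomes an exchange of finite sums. *)
Definition dyadic_mean N f : R :=
  2 ^- N * \sum_(t : N.-tuple bool) f (nth false t).

Lemma Rintegral_depends_on N f : depends_on N f ->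
  \int[haar R]_x f x = dyadic_mean N f.
Proof.
move=> fN; rewrite (@Rintegral_dyadic_split _ N); last exact: depends_on_integrable fN.
rewrite /dyadic_mean mulr_sumr; apply: eq_bigr => t _.
rewrite (@eq_Rintegral _ _ _ (haar R) _ (cst (f (nth false t)))); last first.
  by move=> y /set_mem /fN.
rewrite Rintegral_cst; last exact: measurable_dyadic_interval.
by rewrite /= haar_dyadic_interval mulrC.
Qed.

Lemma eq_dyadic_mean N f g : f =1 g -> dyadic_mean N f = dyadic_mean N g.
Proof. by move=> fg; congr (_ * _); apply: eq_bigr => t _; rewrite fg. Qed.

Lemma dyadic_meanZ N (c : R) f :
  dyadic_mean N (fun x => c * f x) = c * dyadic_mean N f.
Proof. by rewrite /dyadic_mean -mulr_sumr mulrCA. Qed.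

Lemma dyadic_meanD N f g :
  dyadic_mean N (fun x => f x + g x) = dyadic_mean N f + dyadic_mean N g.
Proof. by rewrite /dyadic_mean big_split mulrDr. Qed.

Lemma dyadic_mean_sum N n (F : nat -> dyadic_group -> R) :
  dyadic_mean N (fun x => \sum_(k < n) F k x) = \sum_(k < n) dyadic_mean N (F k).
Proof. by rewrite /dyadic_mean exchange_big mulr_sumr. Qed.

Lemma ler_dyadic_mean N f g : (forall x, f x <= g x) ->
  dyadic_mean N f <= dyadic_mean N g.
Proof.
by move=> fg; rewrite /dyadic_mean ler_wpM2l ?invr_ge0 ?exprn_ge0// ler_sum.
Qed.

Lemma dyadic_mean_exchange M N (K : dyadic_group -> dyadic_group -> R) :
  dyadic_mean M (fun x => dyadic_mean N (K x)) =
  dyadic_mean N (fun y => dyadic_mean M (K^~ y)).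
Proof.
rewrite /dyadic_mean -!mulr_sumr mulrCA; congr (_ * (_ * _)); exact: exchange_big.
Qed.

(** By [is_condexpE] the left side is the value at [x] of a conditional expectation; this bridge
    turns all of them into finite averages. *)
Lemma Rintegral_atom m N f x : (m <= N)%N -> depends_on N f ->
  2 ^+ m * \int[haar R]_(y in dyadic_interval m x) f y =
  dyadic_mean N (fun y => atom_kernel R m x y * f y).
Proof.
move=> mN fN; have aN := depends_on_le mN (@depends_on_atom m x).
rewrite -Rintegral_depends_on; last exact: depends_on_mul.
rewrite Rintegral_mkcond -RintegralZl//; last first.
  rewrite -restrict_EFin.
  apply/(integrable_mkcond _ (@measurable_dyadic_interval m x)).
  by apply: integrableS (depends_on_integrable fN) => //;
    exact: measurable_dyadic_interval.
apply: eq_Rintegral => y _; rewrite patchE /atom_kernel indicE.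
by case: ifP => _; rewrite ?mulr0 ?mulr1 ?mul0r.
Qed.

Lemma dyadic_mean_atom m N x : (m <= N)%N ->
  dyadic_mean N (atom_kernel R m x) = 1.
Proof.
move=> mN; transitivity (dyadic_mean N (fun y => atom_kernel R m x y * 1)).
  by apply: eq_dyadic_mean => y; rewrite mulr1.
rewrite -Rintegral_atom// Rintegral_cst; last exact: measurable_dyadic_interval.
by rewrite /= haar_dyadic_interval mul1r mulfV// expf_neq0.
Qed.

Definition flip_tuple N j (t : N.-tuple bool) : N.-tuple bool :=
  [tuple tnth t i (+) (i == j :> nat) | i < N].

Lemma nth_flip_tuple N j (t : N.-tuple bool) k : (k < N)%N ->
  nth false (flip_tuple j t) k = nth false t k (+) (k == j).
Proof.
move=> kN; rewrite -[k]/(nat_of_ord (Ordinal kN)) -!tnth_nth.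
by rewrite tnth_mktuple.
Qed.

Lemma flip_tupleK N j : involutive (@flip_tuple N j).
Proof.
by move=> t; apply: eq_from_tnth => i; rewrite !tnth_mktuple addbK.
Qed.

(** Flipping coordinate [j] permutes the prefixes, fixes [h] and changes the sign of r_j, so the sum
    is its own opposite. *)
Lemma dyadic_mean_rademacher N j h : (j < N)%N -> depends_on j h ->
  dyadic_mean N (fun x => rademacher R j x * h x) = 0.
Proof.
move=> jN hj; rewrite /dyadic_mean; set s := \sum_(_ | _) _.
suff : s = - s by move=> ss; rewrite (_ : s = 0) ?mulr0//; lra.
rewrite {1}/s (reindex_inj (inv_inj (@flip_tupleK N j)))/= -sumrN.
apply: eq_bigr => t _; rewrite (hj (nth false t)); last first.
  move=> k kj; rewrite nth_flip_tuple; last exact: ltn_trans jN.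
  by rewrite ltn_eqF// addbF.
by rewrite /rademacher nth_flip_tuple// eqxx addbT signrN mulNr.
Qed.

(** If k < 2^m, w_k is constant on the atom. Otherwise the top bit j of k satisfies j >= m, the
    remaining factors depend only on coordinates below j, and r_j averages to 0. *)
Lemma dyadic_mean_walsh m N k x : (m <= N)%N -> (k < 2 ^ N)%N ->
  dyadic_mean N (fun y => atom_kernel R m x y * walsh R k y) =
  (k < 2 ^ m)%:R * walsh R k x.
Proof.
move=> mN kN; have [km|mk] := ltnP k (2 ^ m).
  rewrite mul1r -[RHS]mulr1 -(dyadic_mean_atom x mN) -dyadic_meanZ.
  apply: eq_dyadic_mean => y; rewrite /atom_kernel indicE.
  have [/set_mem xy|] := boolP (y \in _); last by rewrite !mulr0 mul0r.
  by rewrite (walsh_agree R km xy) mulrC.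
have k0 : (0 < k)%N by apply: leq_trans mk; rewrite expn_gt0.
have := trunc_log_bounds (isT : (1 < 2)%N) k0; set j := trunc_log 2 k => /andP[jk kj].
have mj : (m <= j)%N by rewrite -ltnS -(@ltn_exp2l 2)//; exact: leq_ltn_trans kj.
have jN : (j < N)%N by rewrite -(@ltn_exp2l 2)//; exact: leq_ltn_trans kN.
have pj : (k - 2 ^ j < 2 ^ j)%N by rewrite ltn_subLR// addnn -mul2n -expnS.
rewrite -(subnKC jk) mul0r.
under eq_dyadic_mean do rewrite walsh_pow2D// mulrCA.
apply: dyadic_mean_rademacher => //; apply: depends_on_mul.
  exact: depends_on_le mj (@depends_on_atom _ _).
exact: depends_on_walsh.
Qed.

Lemma integral_depends_on N f : depends_on N f ->
  (\int[haar R]_x (f x)%:E = (dyadic_mean N f)%:E)%E.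
Proof.
move=> fN; rewrite -Rintegral_depends_on// /Rintegral fineK//.
by apply: integrable_fin_num => //; exact: depends_on_integrable fN.
Qed.

Lemma L1norm_depends_on N f : depends_on N f ->
  L1norm f = (dyadic_mean N (fun x => `|f x|))%:E.
Proof.
move=> fN; rewrite /L1norm Lnorm1 -integral_depends_on//.
exact: depends_on_normr.
Qed.

End dyadic_average.

(** * The bound in H_1 *)

Lemma atom_kernelC (R : realType) m (x y : dyadic_group) :
  atom_kernel R m x y = atom_kernel R m y x.
Proof.
rewrite /atom_kernel !indicE; congr (_ * (nat_of_bool _)%:R).
by apply/idP/idP => /set_mem h; apply/mem_set => k km; rewrite h.
Qed.

(** * Martingales, their Walsh coefficients and partial sums *)

Section martingales.
Variable R : realType.
Implicit Types (x y : dyadic_group) (F : nat -> dyadic_group -> R).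

Lemma martingale_depends_on F n : is_martingale F -> depends_on n (F n).
Proof. by move=> mF; have [/zeta_measurableP] := mF n n (leqnn n). Qed.

Lemma martingale_mean F m n x : is_martingale F -> (m <= n)%N ->
  F m x = dyadic_mean n (fun y => atom_kernel R m x y * F n y).
Proof.
move=> mF mn; rewrite -Rintegral_atom//; last exact: martingale_depends_on.
exact: is_condexpE (mF m n mn).
Qed.

(** The kernel is symmetric, so E_N moves from F_M onto w_k, which it fixes. Hence the sequence
    defining [walsh_coef] is eventually constant. *)
Lemma martingale_mean_walsh F M N k : is_martingale F -> (N <= M)%N ->
  (k < 2 ^ N)%N ->
  dyadic_mean M (fun x => F M x * walsh R k x) =
  dyadic_mean N (fun x => F N x * walsh R k x).
Proof.
move=> mF NM kN.
under [RHS]eq_dyadic_mean => x do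
  rewrite (martingale_mean x mF NM) mulrC -dyadic_meanZ.
rewrite dyadic_mean_exchange; apply: eq_dyadic_mean => y.
transitivity (F M y * dyadic_mean N (fun x => atom_kernel R N y x * walsh R k x)).
  by rewrite dyadic_mean_walsh// kN mul1r.
by rewrite -dyadic_meanZ; apply: eq_dyadic_mean => x; rewrite atom_kernelC; ring.
Qed.

Lemma walsh_coefE F N k : is_martingale F -> (k < 2 ^ N)%N ->
  walsh_coef F k = dyadic_mean N (fun x => F N x * walsh R k x).
Proof.
move=> mF kN; apply: cvg_lim => //; apply: cvg_near_cst.
exists N => //= M NM; rewrite (@Rintegral_depends_on _ M).
  by rewrite (martingale_mean_walsh mF NM).
apply: depends_on_mul; first exact: martingale_depends_on.
by apply: depends_on_walsh; apply: leq_trans kN _; rewrite leq_exp2l.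
Qed.

Lemma walsh_sumE F N n x : is_martingale F -> (n <= 2 ^ N)%N ->
  walsh_sum n F x = dyadic_mean N (fun y => walsh_kernel R n x y * F N y).
Proof.
move=> mF nN; rewrite /walsh_sum /walsh_kernel.
under eq_dyadic_mean do rewrite mulr_suml.
rewrite (dyadic_mean_sum N n (fun k y => walsh R k x * walsh R k y * F N y)).
apply: eq_bigr => k _; rewrite (walsh_coefE mF (leq_trans (ltn_ord k) nN)).
by rewrite mulrC -dyadic_meanZ; apply: eq_dyadic_mean => y; ring.
Qed.

Lemma walsh_sum_pow2 F m x : is_martingale F -> walsh_sum (2 ^ m) F x = F m x.
Proof.
move=> mF; rewrite (walsh_sumE x mF (leqnn _)) (martingale_mean x mF (leqnn m)).
by apply: eq_dyadic_mean => y; rewrite walsh_kernel_pow2.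
Qed.

Lemma depends_on_walsh_poly (a : nat -> R) N n : (n <= 2 ^ N)%N ->
  depends_on N (fun x => \sum_(k < n) a k * walsh R k x).
Proof.
move=> nN; apply: (@depends_on_sum _ N n (fun k x => a k * walsh R k x)) => k kn.
by move=> x y /(depends_on_walsh R (leq_trans kn nN)) ->.
Qed.

Lemma walsh_poly_mean (a : nat -> R) m N n x : (m <= N)%N -> (n <= 2 ^ N)%N ->
  dyadic_mean N (fun y => atom_kernel R m x y * \sum_(k < n) a k * walsh R k y) =
  \sum_(k < minn n (2 ^ m)) a k * walsh R k x.
Proof.
move=> mN nN; under eq_dyadic_mean do rewrite mulr_sumr.
rewrite (dyadic_mean_sum N n (fun k y => atom_kernel R m x y * (a k * walsh R k y))).
rewrite (big_ord_widen _ (fun k => a k * walsh R k x) (geq_minl n (2 ^ m))).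
rewrite [RHS]big_mkcond/=; apply: eq_bigr => k _.
under eq_dyadic_mean do rewrite mulrCA.
rewrite dyadic_meanZ dyadic_mean_walsh//; last exact: leq_trans (ltn_ord k) nN.
by rewrite leq_min ltn_ord/=; case: ifP => _; rewrite ?mul1r// mul0r mulr0.
Qed.

Lemma condexp_depends_on m N f x : (m <= N)%N -> depends_on N f ->
  condexp m f x = dyadic_mean N (fun y => atom_kernel R m x y * f y).
Proof.
move=> mN fN; rewrite -Rintegral_atom//; apply: is_condexpE.
exact: condexpP (depends_on_integrable fN).
Qed.

(** E_m kills w_k for k >= 2^m and fixes the others, so the martingale attached to a partial sum
    consists of partial sums. *)
Lemma condexp_walsh_sum F m n x :
  condexp m (walsh_sum n F) x = walsh_sum (minn n (2 ^ m)) F x.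
Proof.
have nN : (n <= 2 ^ maxn n m)%N.
  apply: ltnW; apply: (leq_trans (ltn_expl n (isT : (1 < 2)%N))).
  by rewrite leq_exp2l// leq_maxl.
rewrite (@condexp_depends_on _ (maxn n m)) ?leq_maxr//; last exact: depends_on_walsh_poly.
by rewrite walsh_poly_mean// leq_maxr.
Qed.

Lemma abel_summation (b D : nat -> R) N :
  \sum_(j < N) b j * (D j.+1 - D j) = b N * D N - b 0 * D 0 -
    \sum_(1 <= k < N.+1) (b k - b k.-1) * D k.
Proof.
elim: N => [|N IHN]; first by rewrite big_ord0 big_geq// subr0 subrr.
by rewrite big_ord_recr/= IHN [X in _ = _ - X]big_nat_recr//=; ring.
Qed.

Definition variation_step n k : nat := `|(bit n k)%:Z - (bit n k.-1)%:Z|%N.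

Lemma variation_stepE n k :
  (variation_step n k)%:R = `|(bit n k)%:R - (bit n k.-1)%:R| :> R.
Proof. by rewrite /variation_step natr_absz intr_norm rmorphB. Qed.

(** Abel summation in [walsh_kernelE] with [n] digits; the boundary term at [n] vanishes because
    [bit n n] is 0. The majorant combines nonnegative kernels of mean 1 with coefficients of sum
    V(n). *)
Lemma normr_walsh_kernel_le n x y :
  `|walsh_kernel R n x y| <= (bit n 0)%:R * atom_kernel R 0 x y +
     \sum_(1 <= k < n.+1) (variation_step n k)%:R * atom_kernel R k x y.
Proof.
rewrite (walsh_kernelE _ _ _ (ltn_expl n (isT : (1 < 2)%N))).
rewrite !normrM !normr_walsh !mul1r.
rewrite (abel_summation (fun j => (bit n j)%:R) (fun j => atom_kernel R j x y)).
rewrite bit_small// mul0r sub0r -opprD normrN.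
apply: le_trans (ler_normD _ _) _; apply: lerD.
  by rewrite ger0_norm// mulr_ge0// atom_kernel_ge0.
apply: le_trans (ler_norm_sum _ _ _) _; apply: ler_sum => k _.
by rewrite normrM -variation_stepE (ger0_norm (atom_kernel_ge0 _ _ _ _)).
Qed.

(** Schur's test: for fixed y the majorant [K] of the kernel has mean V(n) in x. Depth [n] is enough
    for all averages since n < 2^n. *)
Lemma walsh_sum_L1_le F n : is_martingale F ->
  dyadic_mean n (fun x => `|walsh_sum n F x|) <=
  (dyadic_variation n)%:R * dyadic_mean n (fun x => `|F n x|).
Proof.
move=> mF; have n2 := ltn_expl n (isT : (1 < 2)%N).
pose K x y := (bit n 0)%:R * atom_kernel R 0 x y +
     \sum_(1 <= k < n.+1) (variation_step n k)%:R * atom_kernel R k x y.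
apply: (@le_trans _ _
  (dyadic_mean n (fun x => dyadic_mean n (fun y => K x y * `|F n y|)))).
  apply: ler_dyadic_mean => x; rewrite (walsh_sumE x mF (ltnW n2)).
  rewrite /dyadic_mean normrM ger0_norm ?invr_ge0 ?exprn_ge0//.
  rewrite ler_wpM2l ?invr_ge0 ?exprn_ge0//.
  apply: le_trans (ler_norm_sum _ _ _) _; apply: ler_sum => t _.
  by rewrite normrM ler_wpM2r// normr_walsh_kernel_le.
rewrite dyadic_mean_exchange -dyadic_meanZ.
apply: ler_dyadic_mean => y.
under eq_dyadic_mean do rewrite mulrC.
rewrite dyadic_meanZ mulrC ler_wpM2r// /K dyadic_meanD dyadic_meanZ.
have meanK k : (k <= n)%N -> dyadic_mean n (fun x => atom_kernel R k x y) = 1.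
  move=> kn; rewrite -[RHS](dyadic_mean_atom R y kn).
  by apply: eq_dyadic_mean => x; rewrite atom_kernelC.
rewrite meanK// mulr1 /dyadic_variation natrD lerD2l.
under eq_dyadic_mean do rewrite big_add1/= big_mkord.
rewrite (dyadic_mean_sum n n
  (fun k x => (variation_step n k.+1)%:R * atom_kernel R k.+1 x y)).
rewrite big_add1/= big_mkord natr_sum; apply: ler_sum => k _.
by rewrite dyadic_meanZ meanK// mulr1.
Qed.

(** Zero variation would make all bits equal to bit 0, which is 0, against the top bit of [n]. This
    is what turns 1 + V(n) into 2 V(n). *)
Lemma dyadic_variation_gt0 n : (0 < n)%N -> (0 < dyadic_variation n)%N.
Proof.
move=> n0; rewrite lt0n; apply/eqP => /eqP.
rewrite /dyadic_variation addn_eq0 big_add1/= big_mkord sum_nat_eq0.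
move=> /andP[/eqP b0 /forallP s0].
have bits0 k : (k <= n)%N -> bit n k = 0%N.
  elim: k => // k IHk kn; have := s0 (Ordinal kn).
  by rewrite /= IHk 1?ltnW// subr0 absz_eq0 => /eqP[].
have /andP[jn nj] := trunc_log_bounds (isT : (1 < 2)%N) n0.
have := bits0 _ (ltnW (leq_trans (ltn_expl _ (isT : (1 < 2)%N)) jn)).
rewrite -{1}(subnKC jn) bit_pow2D ?ltnn ?eqxx//.
by rewrite ltn_subLR// addnn -mul2n -expnS.
Qed.

End martingales.

(** * The maximal function and the H_1 norm *)

Section hardy_norm.
Variable R : realType.
Implicit Types (F : nat -> dyadic_group -> R).
Local Open Scope ereal_scope.

Lemma maximal_function_ge F n x : `|F n x|%:E <= maximal_function F x.
Proof. by apply: ereal_sup_ubound; exists n. Qed.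

Lemma maximal_function_ge0 F x : 0 <= maximal_function F x.
Proof. by apply: le_trans (maximal_function_ge F 0 x); rewrite lee_fin. Qed.

Lemma measurable_maximal_function F :
  (forall n, measurable_fun setT (F n)) -> measurable_fun setT (maximal_function F).
Proof.
move=> mF.
rewrite (_ : maximal_function F = (fun x => esups (fun n => `|F n x|%:E) 0%N)).
  apply: measurable_fun_esups => n; apply/measurable_EFinP.
  exact: measurableT_comp.
apply/funext => x; rewrite /maximal_function /esups /sdrop; congr ereal_sup.
by apply/seteqP; split=> _ [n _ <-]; exists n.
Qed.

Lemma H1normE F : H1norm F = \int[haar R]_x maximal_function F x.
Proof.
rewrite /H1norm Lnorm1; apply: eq_integral => x _.
by rewrite gee0_abs// maximal_function_ge0.
Qed.

Lemma H1norm_ge0 F : 0 <= H1norm F.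
Proof. by rewrite H1normE; apply: integral_ge0 => x _; exact: maximal_function_ge0. Qed.

Lemma L1norm_le_H1norm F n : is_martingale F -> L1norm (F n) <= H1norm F.
Proof.
move=> mF; have mm k := depends_on_measurable (@martingale_depends_on _ _ k mF).
rewrite /L1norm Lnorm1 H1normE; apply: ge0_le_integral => //.
- by apply: measurableT_comp => //; apply/measurable_EFinP.
- exact: measurable_maximal_function.
- by move=> x _ /=; rewrite maximal_function_ge.
Qed.

Lemma maximal_function_walsh_sum_le F n x : is_martingale F ->
  maximal_function (martingale_of (walsh_sum n F)) x <=
  maximal_function F x + `|walsh_sum n F x|%:E.
Proof.
move=> mF; apply: ge_ereal_sup => _ [m _ <-].
rewrite /martingale_of condexp_walsh_sum.
have [n2m|n2m] := leqP n (2 ^ m); first by rewrite leeDr// maximal_function_ge0.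
rewrite walsh_sum_pow2//; apply: le_trans (maximal_function_ge F m x) _.
by rewrite leeDl.
Qed.

Lemma H1norm_walsh_sum_le F n : (0 < n)%N -> in_H1 F ->
  H1norm (martingale_of (walsh_sum n F)) <=
  (2 * (dyadic_variation n)%:R)%:E * H1norm F.
Proof.
move=> n0 [mF Foo]; have n2 := ltnW (ltn_expl n (isT : (1 < 2)%N)).
have mm k := depends_on_measurable (@martingale_depends_on _ _ k mF).
have Sn : depends_on n (walsh_sum n F) by exact: depends_on_walsh_poly.
have Smm k : measurable_fun setT (martingale_of (walsh_sum n F) k).
  rewrite (_ : martingale_of _ _ = walsh_sum (minn n (2 ^ k)) F); last first.
    by apply/funext => x; exact: condexp_walsh_sum.
  apply: (@depends_on_measurable _ n); apply: depends_on_walsh_poly.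
  by rewrite geq_min n2.
have mS : measurable_fun setT (fun x => `|walsh_sum n F x|%:E).
  apply/measurable_EFinP; apply: measurableT_comp => //.
  exact: depends_on_measurable Sn.
apply: (@le_trans _ _ (H1norm F + L1norm (walsh_sum n F))).
  rewrite /L1norm Lnorm1 !H1normE -ge0_integralD//; last 2 first.
  - by move=> x _; exact: maximal_function_ge0.
  - exact: measurable_maximal_function.
  apply: ge0_le_integral => //.
  - by move=> x _; exact: maximal_function_ge0.
  - exact: measurable_maximal_function.
  - by apply: emeasurable_funD => //; exact: measurable_maximal_function.
  - by move=> x _; exact: maximal_function_walsh_sum_le.
have := L1norm_le_H1norm n mF.
rewrite (L1norm_depends_on Sn) (L1norm_depends_on (@martingale_depends_on _ _ n mF)).
have := walsh_sum_L1_le n mF; have := H1norm_ge0 F.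
have V1 : (1 <= (dyadic_variation n)%:R :> R)%R.
  by rewrite ler1n dyadic_variation_gt0.
case: (H1norm F) Foo => // h _; rewrite !lee_fin => h0 SV Fh.
apply: (@le_trans _ _ (h + (dyadic_variation n)%:R * h)%R).
  by rewrite lerD2l (le_trans SV)// ler_wpM2l.
have : (h <= (dyadic_variation n)%:R * h)%R by rewrite ler_peMl.
lra.
Qed.

End hardy_norm.

(** * The L_1 norm of the Dirichlet kernel from below *)

Definition origin : dyadic_group := fun=> false.

Section dirichlet_lower_bound.
Variable R : realType.

(** Cuts the group into I_N(0) and the shells I_l(0) \ I_{l+1}(0), on each of which |D_n| is
    explicit. *)
Lemma first_one N (x : dyadic_group) :
  dyadic_interval N origin x \/
  exists l, [/\ (l < N)%N, x l & dyadic_interval l origin x].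
Proof.
elim: N => [|N [IH|[l [lN xl lx]]]]; first by left.
- case xN : (x N); first by right; exists N.
  by left=> k; rewrite ltnS leq_eqVlt => /predU1P[->//|]; exact: IH.
- by right; exists l; split => //; exact: ltnW.
Qed.

Lemma atom_kernel_origin m x : dyadic_interval m origin x ->
  atom_kernel R m origin x = 2 ^+ m.
Proof. by move=> mx; rewrite /atom_kernel indicE mem_set// mulr1. Qed.

Lemma atom_kernel_eq0 m (x y : dyadic_group) l : (l < m)%N -> y l != x l ->
  atom_kernel R m x y = 0.
Proof.
move=> lm ylx; rewrite /atom_kernel indicE memNset ?mulr0// => /(_ l lm) e.
by rewrite e eqxx in ylx.
Qed.

Lemma sum_bits_ge0 n l : 0 <= \sum_(j < l) (bit n j)%:R * 2 ^+ j :> R.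
Proof. by apply: sumr_ge0 => j _; rewrite mulr_ge0// exprn_ge0. Qed.

Lemma sum_bits_le n l : \sum_(j < l) (bit n j)%:R * 2 ^+ j <= 2 ^+ l :> R.
Proof.
elim: l => [|l IHl]; first by rewrite big_ord0 expr0.
rewrite big_ord_recr/= exprS mulr2n mulrDl mul1r lerD//.
by rewrite ler_piMl ?exprn_ge0// /bit; case: odd.
Qed.

(** [variation_step n 0] is 0 because [0.-1] is [0]; index 0 must carry the summand n_0 of V(n)
    instead. *)
Definition variation_term n l : nat := if l is 0 then bit n 0 else variation_step n l.

(** The right side is |D_n| on the l-th shell. For l > 0 only n_l <> n_{l-1} matters: if n_{l-1} = 1
    the sum is at least 2^(l-1); if n_l = 1 the lower bits reach at most 2^(l-1), half of 2^l. *)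
Lemma variation_bits_le n l :
  2^-1 * 2 ^+ l * (variation_term n l)%:R <=
  `|\sum_(j < l) (bit n j)%:R * 2 ^+ j - (bit n l)%:R * 2 ^+ l| :> R.
Proof.
case: l => [|l].
  by rewrite big_ord0 expr0 !mulr1 sub0r normrN ger0_norm//= ler_piMl// invf_le1// ler1n.
rewrite big_ord_recr/= variation_stepE exprS.
have := sum_bits_ge0 n l; have := sum_bits_le n l.
set s := \sum_(_ | _) _; have : 0 < 2 ^+ l :> R by rewrite exprn_gt0.
rewrite /bit /=; set p := 2 ^+ l; case: odd; case: odd => /=;
  rewrite ?subrr ?normr0 ?subr0 ?sub0r ?normrN ?normr1 => p0 sp s0.
all: rewrite ?mulr0 ?mul0r ?addr0 ?subr0 ?sub0r ?mulr1 ?mul1r//.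
- rewrite ler0_norm; lra.
- rewrite ger0_norm; lra.
Qed.

(** The shells are disjoint, so one sum encodes all the local bounds. If the first 1 of x is at l,
    then D_{2^(j+1)} - D_{2^j} is 2^j for j < l, -2^l for j = l and 0 beyond. *)
Lemma walsh_kernel_origin_ge n x :
  \sum_(l < n.+1) (variation_term n l)%:R / 2 *
    (2 ^+ l * (\1_(dyadic_interval l origin) x - \1_(dyadic_interval l.+1 origin) x))
  <= `|walsh_kernel R n origin x|.
Proof.
have [xN|[l [lN xl lx]]] := first_one n.+1 x.
  rewrite big1// => l _; rewrite !indicE !mem_set ?subrr ?mulr0// => k kl.
    by apply: xN; apply: leq_trans kl _; exact: ltn_ord.
  by apply: xN; apply: ltn_trans kl _; exact: ltn_ord.
have n2 : (n < 2 ^ n.+1)%N by apply: ltnW; exact: ltn_expl.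
rewrite (walsh_kernelE _ _ _ n2) !normrM !normr_walsh !mul1r.
have atomgt k : (l < k)%N -> atom_kernel R k origin x = 0.
  by move=> lk; apply: atom_kernel_eq0 lk _; rewrite xl.
have atomle k : (k <= l)%N -> dyadic_interval k origin x.
  by move=> kl j jk; apply: lx; exact: leq_trans kl.
rewrite (bigD1 (Ordinal lN))//= [X in _ + X]big1 ?addr0; last first.
  move=> k; rewrite -val_eqE/= neq_ltn => /orP[kl|lk].
    by rewrite !indicE !mem_set ?subrr ?mulr0//; apply: atomle => //; exact: ltnW.
  have := atomgt _ lk; rewrite /atom_kernel mulrBr => ->.
  have := atomgt k.+1 (ltnW lk); rewrite /atom_kernel exprS => /eqP.
  by rewrite -mulrA mulf_eq0 pnatr_eq0/= => /eqP ->; rewrite subrr mulr0.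
rewrite indicE mem_set// indicE memNset ?subr0 ?mulr1; last first.
  by move=> /(_ l (ltnSn l)); rewrite xl.
rewrite [leLHS](_ : _ = 2^-1 * 2 ^+ l * (variation_term n l)%:R); last by ring.
apply: le_trans (variation_bits_le n l) _.
rewrite le_eqVlt; apply/orP; left; apply/eqP; congr `|_|.
rewrite -(big_mkord xpredT (fun j => (bit n j)%:R *
  (atom_kernel R j.+1 origin x - atom_kernel R j origin x))).
rewrite (big_cat_nat (leq0n l) (ltnW lN))/=.
rewrite -(big_mkord xpredT (fun j => (bit n j)%:R * 2 ^+ j)); congr (_ + _).
  apply: eq_big_nat => j /= jl; rewrite !atom_kernel_origin//; try exact: atomle (ltnW _).
    by rewrite exprS; congr (_ * _); ring.
  exact: atomle.
rewrite big_ltn// [X in _ + X]big_nat_cond [X in _ + X]big1 ?addr0.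
  by rewrite atomgt// atom_kernel_origin// sub0r mulrN.
by move=> j; rewrite andbT => /andP[lj _]; rewrite !atomgt ?subrr ?mulr0// ltnW.
Qed.

Lemma dirichlet_L1_ge N n : (n < N)%N ->
  (dyadic_variation n)%:R / 4 <=
  dyadic_mean N (fun x => `|walsh_kernel R n origin x|).
Proof.
move=> nN; apply: le_trans (ler_dyadic_mean N (walsh_kernel_origin_ge n)).
rewrite (dyadic_mean_sum N n.+1 (fun l x => (variation_term n l)%:R / 2 *
  (2 ^+ l * (\1_(dyadic_interval l origin) x - \1_(dyadic_interval l.+1 origin) x)))).
rewrite (eq_bigr (fun l : 'I_n.+1 => (variation_term n l)%:R / 4)).
  rewrite -mulr_suml ler_wpM2r// -natr_sum ler_nat.
  rewrite /dyadic_variation big_ord_recl/= leq_add2l big_add1/= big_mkord.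
  by apply: eq_leq; apply: eq_bigr => i _.
move=> l _; rewrite dyadic_meanZ.
have -> : dyadic_mean N (fun x => 2 ^+ l * (\1_(dyadic_interval l origin) x -
    \1_(dyadic_interval l.+1 origin) x)) = 2^-1 :> R.
  have lN : (l < N)%N by exact: leq_trans (ltn_ord l) nN.
  (* The shell has measure 2^-(l+1): the indicator of I_{l+1}(0) times 2^l is half of D_{2^(l+1)},
     leaving 1 - 1/2. *)
  transitivity (dyadic_mean N (fun x => atom_kernel R l origin x +
      (- 2^-1) * atom_kernel R l.+1 origin x)).
    by apply: eq_dyadic_mean => x; rewrite /atom_kernel exprS; field.
  rewrite dyadic_meanD (dyadic_meanZ N (- 2^-1)) !dyadic_mean_atom ?(ltnW lN)//.
  by field.
by field.
Qed.

End dirichlet_lower_bound.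

(** * Divergence *)

Section hump_martingale.
Variable R : realType.
Implicit Types (x y : dyadic_group).

Lemma walsh_origin k : walsh R k origin = 1.
Proof. by rewrite /walsh big1// => i _; rewrite /rademacher expr0 expr1n. Qed.

(** The factor [1] exhibits a Walsh polynomial with explicit coefficients, the shape required by
    [walsh_poly_mean]. *)
Lemma atom_kernel_walsh_sum j x :
  atom_kernel R j origin x = \sum_(k < 2 ^ j) 1 * walsh R k x.
Proof.
rewrite -walsh_kernel_pow2; apply: eq_bigr => k _.
by rewrite walsh_origin.
Qed.

Lemma atom_kernel_mean m j N x : (m <= N)%N -> (j <= N)%N ->
  dyadic_mean N (fun y => atom_kernel R m x y * atom_kernel R j origin y) =
  atom_kernel R (minn j m) origin x.
Proof.
move=> mN jN; under eq_dyadic_mean do rewrite atom_kernel_walsh_sum.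
rewrite (walsh_poly_mean (fun=> 1))// ?leq_exp2l// atom_kernel_walsh_sum.
suff -> : minn (2 ^ j) (2 ^ m) = (2 ^ minn j m)%N by [].
by rewrite /minn ltn_exp2l//; case: ifP.
Qed.

Variable c : nat -> R.
Hypothesis c0 : forall j, 0 <= c j.

(** The j-th hump r_j D_{2^j} has its Walsh spectrum in [2^j, 2^(j+1)), so distinct humps occupy
    disjoint blocks of frequencies. *)
Definition hump n x : R :=
  \sum_(j < n) c j * (atom_kernel R j.+1 origin x - atom_kernel R j origin x).

Lemma depends_on_hump n : depends_on n (hump n).
Proof.
apply: (@depends_on_sum _ n n (fun j x => c j * (atom_kernel R j.+1 origin x -
  atom_kernel R j origin x))) => k kn x y xy.
rewrite (depends_on_le kn (@depends_on_atom _ _ _) xy).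
by rewrite (depends_on_le (ltnW kn) (@depends_on_atom _ _ _) xy).
Qed.

(** E_m fixes the humps below [m] and sends each later one to D_{2^m} - D_{2^m} = 0. *)
Lemma hump_mean m n x : (m <= n)%N ->
  dyadic_mean n (fun y => atom_kernel R m x y * hump n y) = hump m x.
Proof.
move=> mn; under eq_dyadic_mean do rewrite mulr_sumr.
rewrite (dyadic_mean_sum n n (fun j y => atom_kernel R m x y * (c j *
  (atom_kernel R j.+1 origin y - atom_kernel R j origin y)))).
have term j : (j < n)%N -> dyadic_mean n (fun y => atom_kernel R m x y * (c j *
    (atom_kernel R j.+1 origin y - atom_kernel R j origin y))) =
    c j * (atom_kernel R (minn j.+1 m) origin x - atom_kernel R (minn j m) origin x).
  move=> jn; rewrite -(@atom_kernel_mean m j.+1 n)//.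
  rewrite -(@atom_kernel_mean m j n)// 1?ltnW//.
  rewrite -mulN1r -(dyadic_meanZ n (-1)) -dyadic_meanD -dyadic_meanZ.
  by apply: eq_dyadic_mean => y; ring.
transitivity (\sum_(j < n) c j * (atom_kernel R (minn j.+1 m) origin x -
    atom_kernel R (minn j m) origin x)).
  by apply: eq_bigr => j _; rewrite term.
rewrite -(big_mkord xpredT (fun j => c j * (atom_kernel R (minn j.+1 m) origin x -
    atom_kernel R (minn j m) origin x))) (big_cat_nat (leq0n m) mn)/=.
rewrite [X in _ + X]big_nat_cond [X in _ + X]big1 ?addr0; last first.
  move=> j; rewrite andbT => /andP[mj _].
  by rewrite !(minn_idPr _)// ?subrr ?mulr0// leqW.
rewrite big_mkord; apply: eq_bigr => j _.
by rewrite !(minn_idPl _)// ltnW.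
Qed.

Lemma is_martingale_hump : is_martingale hump.
Proof.
move=> m n mn; have hi := depends_on_integrable (@depends_on_hump n).
have := @is_condexp_mean R m _ hi.
rewrite (_ : (fun x => _ * _) = hump m)//; apply/funext => x.
by rewrite (@Rintegral_atom _ _ n) ?hump_mean//; exact: depends_on_hump.
Qed.

Lemma walsh_coef_hump i k : (2 ^ i <= k < 2 ^ i.+1)%N -> walsh_coef hump k = c i.
Proof.
move=> /andP[ik ki]; rewrite (walsh_coefE is_martingale_hump ki).
under eq_dyadic_mean do rewrite mulr_suml.
rewrite (dyadic_mean_sum i.+1 i.+1 (fun j x => c j * (atom_kernel R j.+1 origin x -
  atom_kernel R j origin x) * walsh R k x)).
have term j : (j < i.+1)%N -> dyadic_mean i.+1 (fun x => c j *
    (atom_kernel R j.+1 origin x - atom_kernel R j origin x) * walsh R k x) =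
    c j * ((k < 2 ^ j.+1)%N%:R - (k < 2 ^ j)%N%:R).
  have mean l : (l <= i.+1)%N -> (k < 2 ^ l)%N%:R =
      dyadic_mean i.+1 (fun x => atom_kernel R l origin x * walsh R k x).
    by move=> li; rewrite dyadic_mean_walsh// walsh_origin mulr1.
  move=> ji; rewrite !mean// 1?ltnW//.
  rewrite -mulN1r -(dyadic_meanZ i.+1 (-1)) -dyadic_meanD -dyadic_meanZ.
  by apply: eq_dyadic_mean => y; ring.
rewrite (eq_bigr (fun j : 'I_i.+1 => c j * ((k < 2 ^ j.+1)%N%:R - (k < 2 ^ j)%N%:R))).
  rewrite big_ord_recr/= ki ltnNge ik/= subr0 mulr1 big1 ?add0r// => j _.
  have jk l : (l <= i)%N -> (k < 2 ^ l)%N = false.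
    by move=> li; apply/negbTE; rewrite -leqNgt (leq_trans _ ik)// leq_exp2l.
  by rewrite !jk// ?subrr ?mulr0// ltnW.
by move=> j _; rewrite term.
Qed.

Lemma walsh_sum_hump i p x : (p < 2 ^ i)%N -> walsh_sum (2 ^ i + p) hump x =
  hump i x + c i * (walsh_kernel R (2 ^ i + p) origin x - atom_kernel R i origin x).
Proof.
move=> pi; rewrite -(walsh_sum_pow2 i x is_martingale_hump) -walsh_kernel_pow2.
rewrite /walsh_sum /walsh_kernel !big_split_ord/=; congr (_ + _).
rewrite addrAC subrr add0r mulr_sumr; apply: eq_bigr => k _.
rewrite (@walsh_coef_hump i) ?walsh_origin ?mul1r//.
by rewrite leq_addr/= expnS mul2n -addnn ltn_add2l (ltn_trans (ltn_ord k)).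
Qed.

(** Each hump is a sign times D_{2^j}. The bound increases with [n], so its limit dominates the
    maximal function. *)
Lemma normr_hump_le n x :
  `|hump n x| <= \sum_(j < n) c j * atom_kernel R j origin x.
Proof.
apply: le_trans (ler_norm_sum _ _ _) _; apply: ler_sum => j _.
have r1 y : `|rademacher R j y| = 1 by rewrite /rademacher normrX normrN1 expr1n.
rewrite normrM (ger0_norm (c0 j)) ler_wpM2l// atom_kernel_diff.
by rewrite 2!normrM !r1 !mul1r (ger0_norm (atom_kernel_ge0 _ _ _ _)).
Qed.

Variable B : R.
Hypothesis cB : forall n, \sum_(j < n) c j <= B.

Lemma hump_L1_le n N : (n <= N)%N -> dyadic_mean N (fun x => `|hump n x|) <= B.
Proof.
move=> nN; apply: le_trans (ler_dyadic_mean N (normr_hump_le n)) _.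
rewrite (dyadic_mean_sum N n (fun j x => c j * atom_kernel R j origin x)).
apply: le_trans (cB n); apply: ler_sum => j _.
rewrite (dyadic_meanZ N (c j)) dyadic_mean_atom ?mulr1//.
by apply: leq_trans nN; exact: ltnW.
Qed.

(** The series of c_j D_{2^j} dominates the maximal function; integrated termwise, with each D_{2^j}
    of mean 1, it gives at most [B]. *)
Lemma in_H1_hump : in_H1 hump.
Proof.
split; first exact: is_martingale_hump.
have ca0 j x : (0 <= (c j * atom_kernel R j origin x)%:E)%E.
  by rewrite lee_fin mulr_ge0// atom_kernel_ge0.
have dca j : depends_on j (fun x => c j * atom_kernel R j origin x).
  by move=> x y /(@depends_on_atom R j origin) ->.
have mca j : measurable_fun setT (fun x => (c j * atom_kernel R j origin x)%:E).
  by apply/measurable_EFinP; exact: depends_on_measurable (dca j).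
have mh n := depends_on_measurable (@depends_on_hump n).
rewrite H1normE; apply: (@le_lt_trans _ _ B%:E); last exact: ltry.
apply: (@le_trans _ _
    (\int[haar R]_x \sum_(0 <= j <oo) (c j * atom_kernel R j origin x)%:E)%E).
  apply: ge0_le_integral => //.
  - by move=> x _; exact: maximal_function_ge0.
  - exact: measurable_maximal_function.
  - by apply: ge0_emeasurable_sum => // j x _ _; exact: ca0.
  - move=> x _; apply: ge_ereal_sup => _ [n _ <-].
    apply: (@le_trans _ _ (\sum_(0 <= j < n) (c j * atom_kernel R j origin x)%:E)%E).
      by rewrite sumEFin lee_fin big_mkord normr_hump_le.
    by apply: nneseries_lim_ge => j _ _; exact: ca0.
rewrite integral_nneseries//.
apply: lime_le; first by apply: is_cvg_nneseries => j _ _; apply: integral_ge0.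
apply: nearW => n; rewrite (eq_bigr (fun j => (c j)%:E)).
  by rewrite sumEFin lee_fin big_mkord.
move=> j _; rewrite (integral_depends_on (dca j)) (dyadic_meanZ j (c j)).
by rewrite dyadic_mean_atom// mulr1.
Qed.

Lemma walsh_sum_hump_L1_ge n N : (0 < n)%N -> (n < N)%N ->
  c (trunc_log 2 n) * ((dyadic_variation n)%:R / 4) <=
  dyadic_mean N (fun x => `|walsh_sum n hump x|) + B + B.
Proof.
move=> n0 nN; have /andP[] := trunc_log_bounds (isT : (1 < 2)%N) n0.
set i := trunc_log 2 n => i_n ni.
have iN : (i < N)%N.
  by apply: leq_trans nN; rewrite ltnS; apply: leq_trans i_n; apply: ltnW; exact: ltn_expl.
have pi : (n - 2 ^ i < 2 ^ i)%N by rewrite ltn_subLR// addnn -mul2n -expnS.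
have S_ge x : c i * `|walsh_kernel R n origin x| <=
    `|walsh_sum n hump x| + `|hump i x| + c i * atom_kernel R i origin x.
  have := walsh_sum_hump x pi; rewrite subnKC// => SE.
  rewrite -[in leLHS](ger0_norm (c0 i)) -normrM.
  rewrite (_ : c i * walsh_kernel R n origin x =
    walsh_sum n hump x - hump i x + c i * atom_kernel R i origin x); last first.
    by rewrite SE; ring.
  apply: le_trans (ler_normD _ _) _; apply: lerD; first exact: ler_normB.
  by rewrite ger0_norm// mulr_ge0// atom_kernel_ge0.
apply: (@le_trans _ _ (c i * dyadic_mean N (fun x => `|walsh_kernel R n origin x|))).
  by rewrite ler_wpM2l// dirichlet_L1_ge.
rewrite -dyadic_meanZ; apply: le_trans (ler_dyadic_mean N S_ge) _.
rewrite !dyadic_meanD (dyadic_meanZ N (c i)) dyadic_mean_atom ?(ltnW iN)// mulr1.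
rewrite lerD//; first by rewrite lerD2l hump_L1_le// ltnW.
(* The first [B] paid for the norm of [hump i]; the second pays for c_i D_{2^i}, since c_i is one
   term of a nonnegative sum bounded by [B]. *)
apply: le_trans (cB i.+1); rewrite big_ord_recr/= lerDr.
exact: sumr_ge0.
Qed.

End hump_martingale.

Lemma sum_half_pow_le (R : realType) n : \sum_(i < n) 2 ^- i <= 2 :> R.
Proof.
suff -> : \sum_(i < n) 2 ^- i = 2 - 2 * 2 ^- n :> R.
  by rewrite gerBl mulr_ge0// invr_ge0 exprn_ge0.
elim: n => [|n IHn]; first by rewrite big_ord0 expr0 invr1 mulr1 subrr.
by rewrite big_ord_recr/= IHn exprS invfM; field; rewrite expf_neq0.
Qed.

Lemma sum_delta_le1 (R : realType) (L n : nat) : \sum_(j < n) (L == j)%:R <= 1 :> R.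
Proof.
have [Ln|nL] := ltnP L n.
  rewrite (bigD1 (Ordinal Ln))//= eqxx big1 ?addr0// => j.
  by rewrite -val_eqE/= eq_sym => /negbTE ->.
by rewrite big1// => j _; rewrite gtn_eqF// (leq_trans (ltn_ord j)).
Qed.

(** * Weights of the humps *)

Section weights.
Variables (R : realType) (L : nat -> nat).
Hypothesis leL : forall i, (i <= L i)%N.

(** Several [i] may share a position, so their contributions 2^-i are added. By [leL], L i = j
    forces i <= j, hence the finite range. *)
Definition weight j : R := \sum_(i < j.+1) (L i == j)%:R * 2 ^- i.

Lemma weight_ge0 j : 0 <= weight j.
Proof. by apply: sumr_ge0 => i _; rewrite mulr_ge0// invr_ge0 exprn_ge0. Qed.

Lemma weight_ge i : 2 ^- i <= weight (L i).
Proof.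
have iL : (i < (L i).+1)%N by rewrite ltnS.
rewrite /weight (bigD1 (Ordinal iL))//= eqxx mul1r lerDl.
by apply: sumr_ge0 => j _; rewrite mulr_ge0// invr_ge0 exprn_ge0.
Qed.

(** After exchanging the sums, each [i] contributes 2^-i to at most one position. *)
Lemma sum_weight_le n : \sum_(j < n) weight j <= 2.
Proof.
apply: le_trans (sum_half_pow_le R n).
rewrite (eq_bigr (fun j : 'I_n => \sum_(i < n) (L i == j)%:R * 2 ^- i)).
  rewrite exchange_big/=; apply: ler_sum => i _.
  by rewrite -mulr_suml ler_piMl ?sum_delta_le1// invr_ge0 exprn_ge0.
move=> j _; rewrite /weight (big_ord_widen n (fun i => (L i == j)%:R * 2 ^- i))//.
rewrite big_mkcond/=; apply: eq_bigr => i _; rewrite ltnS; case: leqP => // ji.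
by rewrite gtn_eqF ?mul0r// (leq_trans ji).
Qed.

End weights.

(** * Choice of the subsequence and divergence *)

Lemma limn_esup_pinfty (R : realType) (u : nat -> R) (A : R) N :
  limn_esup (fun k => (u k)%:E) = +oo%E -> exists2 k, (N <= k)%N & A < u k.
Proof.
move=> /ereal_inf_pinfty uoo.
have /uoo supoo : [set ereal_sup [set (u k)%:E | k in V] | V in \oo]
    (ereal_sup [set (u k)%:E | k in [set k | (N <= k)%N]]).
  by exists [set k | (N <= k)%N] => //; exists N.
have /ereal_sup_gt : (A%:E < ereal_sup [set (u k)%:E | k in [set k | (N <= k)%N]])%E.
  by rewrite supoo ltry.
by move=> [_ [k /= Nk <-]]; rewrite lte_fin => Ak; exists k.
Qed.

Lemma exists_unbounded_walsh_sum (R : realType) (m : nat -> nat) (Phi : nat -> R) :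
  (forall k, (0 < m k)%N) ->
  {homo m : i j / (i < j)%N} ->
  (forall n, (0 < n)%N -> 1 <= Phi n) ->
  limn_esup (fun k => ((dyadic_variation (m k))%:R / Phi (m k))%:E) = +oo%E ->
  exists F : nat -> dyadic_group -> R,
    in_H1 F /\
    ereal_sup (range (fun k =>
      L1norm (fun x => walsh_sum (m k) F x / Phi (m k)))) = +oo%E.
Proof.
move=> m0 mlt Phi1 lim.
have km k : (k <= m k)%N.
  by elim: k => // k IHk; apply: (leq_ltn_trans IHk); exact: mlt.
(* With m_k >= k, the condition 2^i <= k puts the top bit of m_k at position i or later. The rate
   4^i outweighs the weight 2^-i and still leaves 2^i. *)
have /choice[k_ k_P] i : exists k, (2 ^ i <= k)%N /\
    4 ^+ i < (dyadic_variation (m k))%:R / Phi (m k).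
  by have [k ? ?] := limn_esup_pinfty (4 ^+ i) (2 ^ i) lim; exists k.
pose L i := trunc_log 2 (m (k_ i)).
have leL i : (i <= L i)%N.
  by apply: trunc_log_max => //; apply: leq_trans (km _); exact: (k_P i).1.
have w0 := @weight_ge0 R L; have w2 := sum_weight_le R leL.
exists (hump (weight R L)); split; first exact: in_H1_hump w2.
apply/eqyP => A _.
(* The 8 more than absorbs the error 2 + 2 from [walsh_sum_hump_L1_ge], because [phi] is at least
   1. *)
have [i Ai] : exists i : nat, A + 8 <= 2 ^+ i / 4.
  exists (Num.bound `|4 * (A + 8)|).
  rewrite ler_pdivlMr// mulrC; apply: le_trans (ler_norm _) _.
  apply: le_trans (ltW (archi_boundP (normr_ge0 _))) _.
  by rewrite -natrX ler_nat ltnW// ltn_expl.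
apply: le_trans (ereal_sup_ubound _); last by exists (k_ i).
set n := m (k_ i); have := (k_P i).2; rewrite -/n.
have n0 : (0 < n)%N by exact: m0.
have := Phi1 n n0; set phi := Phi n => phi1 Vphi.
have phi0 : 0 < phi by exact: lt_le_trans phi1.
have n2 : (n <= 2 ^ n.+1)%N by apply: ltnW; apply: ltnW; exact: ltn_expl.
have Sd : depends_on n.+1 (fun x => walsh_sum n (hump (weight R L)) x / phi).
  move=> x y xy; congr (_ / _).
  exact: (depends_on_walsh_poly (walsh_coef (hump (weight R L))) n2 xy).
rewrite (L1norm_depends_on Sd) lee_fin.
have := walsh_sum_hump_L1_ge w0 w2 n0 (ltnSn n).
set V : R := (dyadic_variation n)%:R in Vphi *.
rewrite (@eq_dyadic_mean _ n.+1 (fun x => `|_ / _|)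
  (fun x => phi^-1 * `|walsh_sum n (hump (weight R L)) x|)); last first.
  by move=> x; rewrite normrM mulrC normfV (gtr0_norm phi0).
rewrite dyadic_meanZ; set S := dyadic_mean _ _ => VS.
rewrite mulrC ler_pdivlMr//.
have wV : 2 ^- i * (V / 4) <= S + 2 + 2.
  by apply: le_trans VS; rewrite ler_wpM2r ?divr_ge0//; exact: weight_ge.
have p0 : 0 < 2 ^+ i :> R by rewrite exprn_gt0.
have : 2 ^+ i / 4 * phi <= 2 ^- i * (V / 4).
  rewrite (_ : 2 ^- i * _ = 2 ^- i * V / 4); last by rewrite mulrA.
  rewrite mulrAC ler_wpM2r// ler_pdivlMl// mulrA -exprMn -natrM.
  by rewrite -ler_pdivlMr// ltW.
have : (A + 8) * phi <= 2 ^+ i / 4 * phi by rewrite ler_wpM2r// ltW.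
lra.
Qed.

Theorem theorem2 (R : realType) :
  (exists c : R, forall (n : nat) (F : nat -> dyadic_group -> R),
     (0 < n)%N -> in_H1 F ->
     (H1norm (martingale_of (walsh_sum n F))
        <= (c * (dyadic_variation n)%:R)%:E * H1norm F)%E)
  /\
  (forall (m : nat -> nat) (Phi : nat -> R),
     (forall k, (0 < m k)%N) ->
     {homo m : i j / (i < j)%N} ->
     ereal_sup (range (fun k => (dyadic_variation (m k))%:R%:E)) = +oo%E :> \bar R ->
     (forall n, (0 < n)%N -> 1 <= Phi n) ->
     (forall i j, (0 < i)%N -> (i <= j)%N -> Phi i <= Phi j) ->
     limn_esup (fun k => ((dyadic_variation (m k))%:R / Phi (m k))%:E) = +oo%E ->
     exists F : nat -> dyadic_group -> R,
       in_H1 F /\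
       ereal_sup (range (fun k =>
         L1norm (fun x => walsh_sum (m k) F x / Phi (m k))))
         = +oo%E).

Proof.
split; first by exists 2 => n F; exact: H1norm_walsh_sum_le.
move=> m Phi m0 mlt _ Phi1 _; exact: exists_unbounded_walsh_sum.
Qed.
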